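(* Let $\mathcal L(\lambda)=L_0+\lambda L_1+\cdots+\lambda^pL_p$ be a selfadjoint matrix pencil of odd degree $p=2\ell+1$ acting on $X=\mathbb{C}^N$, and suppose that $L_p$ is invertible. Then \[ N-2N_-(L_0)-Z^\downarrow_+(\mathcal L)-Z^\downarrow_-(\mathcal L)+\sum_{\lambda\in\sigma(\mathcal L),\,\lambda>0}\kappa(\lambda)-\sum_{\lambda\in\sigma(\mathcal L),\,\lambda<0}\kappa(\lambda)=0, \] and moreover \[ N_\pm(\mathcal L)\ \ge\ \bigl|N_-(L_0)+Z^\downarrow_\pm(\mathcal L)-N_\mp(L_p)\bigr|. \]
   Context: The pencil is selfadjoint: every $L_j$ is an $N\times N$ Hermitian matrix. Its characteristic values are the $\lambda\in\mathbb{C}$ with $\det\mathcal L(\lambda)=0$, and $\sigma(\mathcal L)$ is the set of them. For real $\lambda$, the $N$ eigenvalues of the Hermitian matrix $\mathcal L(\lambda)$ can be chosen as $N$ real analytic functions $\mu=\mu(\lambda)$ of $\lambda\in\mathbb{R}$ (eigenvalue branches, counted with multiplicity). For a Hermitian matrix $A$, $N_+(A)$ (resp. $N_-(A)$) is the number of strictly positive (resp. negative) eigenvalues counted with multiplicity. For the pencil, $N_+(\mathcal L)$ (resp. $N_-(\mathcal L)$) is the number of strictly positive (resp. negative) real characteristic values counted with geometric multiplicity $\dim\ker\mathcal L(\lambda)$. $Z^\downarrow_+(\mathcal L)$ (resp. $Z^\downarrow_-(\mathcal L)$) is the number of eigenvalue branches with $\mu(0)=0$ and $\mu(\lambda)<0$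 for all sufficiently small $\lambda>0$ (resp. $\lambda<0$). Krein signature (graphical): if $\lambda_0\in\mathbb{R}$ is a characteristic value and $\mu$ is a branch with $\mu^{(n)}(\lambda_0)=0$ for $n<m$ and $\mu^{(m)}(\lambda_0)\ne0$, set $\eta=\operatorname{sign}\mu^{(m)}(\lambda_0)$ and $\kappa^\pm(\mu,\lambda_0)=m/2$ if $m$ is even, $\kappa^\pm(\mu,\lambda_0)=(m\pm\eta)/2$ if $m$ is odd. Then $\kappa^\pm(\lambda_0)$ is the sum of $\kappa^\pm(\mu,\lambda_0)$ over all branches vanishing at $\lambda_0$, and $\kappa(\lambda_0)=\kappa^+(\lambda_0)-\kappa^-(\lambda_0)$. The sums in the identity run over real characteristic values only. *)

(* Defs.v *)
From HB Require Import structures.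
From mathcomp Require Import all_boot all_order all_algebra.
From mathcomp Require Import all_classical all_reals all_analysis.
From mathcomp Require Import complex.
Set Implicit Arguments. Unset Strict Implicit. Unset Printing Implicit Defensive.
Import Order.TTheory GRing.Theory Num.Theory.
Import numFieldNormedType.Exports.
Local Open Scope ring_scope.
Local Open Scope classical_set_scope.

Definition rC (R : realType) (x : R) : R[i] := (x%:C)%C.

Definition hermitian_mx (R : realType) (N : nat) (A : 'M[R[i]]_N) : Prop :=
  map_mx Num.conj (A^T) = A.

Definition pencil_at (R : realType) (N p : nat) (L : 'I_p.+1 -> 'M[R[i]]_N)
  (z : R[i]) : 'M[R[i]]_N :=
  \sum_(j < p.+1) (z ^+ j) *: L j.

Definition eigenvalues (R : realType) (N : nat) (A : 'M[R[i]]_N) : seq R[i] :=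
  sval (closed_field_poly_normal (char_poly A)).

(* N_+(A), N_-(A): number of strictly positive / negative eigenvalues,
   counted with multiplicity (for Hermitian A all eigenvalues are real;
   in R[i], 0 < z means z is real and positive) *)
Definition Npos_mx (R : realType) (N : nat) (A : 'M[R[i]]_N) : nat :=
  count (fun z => 0 < z) (eigenvalues A).
Definition Nneg_mx (R : realType) (N : nat) (A : 'M[R[i]]_N) : nat :=
  count (fun z => z < 0) (eigenvalues A).

Definition charval (R : realType) (N p : nat) (L : 'I_p.+1 -> 'M[R[i]]_N)
  (z : R[i]) : Prop :=
  \det (pencil_at L z) = 0.

Definition geom_mult (R : realType) (N p : nat) (L : 'I_p.+1 -> 'M[R[i]]_N)
  (x : R) : nat :=
  (N - \rank (pencil_at L (rC x)))%N.

Definition Npos_pencil (R : realType) (N p : nat) (L : 'I_p.+1 -> 'M[R[i]]_N) : nat :=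
  (\sum_(x \in [set x : R | 0 < x /\ charval L (rC x)]) geom_mult L x)%R.
Definition Nneg_pencil (R : realType) (N p : nat) (L : 'I_p.+1 -> 'M[R[i]]_N) : nat :=
  (\sum_(x \in [set x : R | x < 0 /\ charval L (rC x)]) geom_mult L x)%R.

Definition real_analytic (R : realType) (f : R -> R) : Prop :=
  forall x0 : R, exists r : R, 0 < r /\
    exists a : nat -> R, forall x : R, `|x - x0| < r ->
      [series a k * (x - x0) ^+ k]_k @ \oo --> f x.

Definition eigen_branches (R : realType) (N p : nat) (L : 'I_p.+1 -> 'M[R[i]]_N)
  (mu : 'I_N -> R -> R) : Prop :=
  (forall i, real_analytic (mu i)) /\
  (forall x : R, char_poly (pencil_at L (rC x)) = \prod_(i < N) ('X - (rC (mu i x))%:P)).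

Definition Zdown_pos (R : realType) (N : nat) (mu : 'I_N -> R -> R) : nat :=
  #|[set i : 'I_N | `[< mu i 0 = 0 /\ \forall x \near 0^'+, mu i x < 0 >]]|.
Definition Zdown_neg (R : realType) (N : nat) (mu : 'I_N -> R -> R) : nat :=
  #|[set i : 'I_N | `[< mu i 0 = 0 /\ \forall x \near 0^'-, mu i x < 0 >]]|.

Definition vanish_order_is (R : realType) (f : R -> R) (x0 : R) (m : nat) : Prop :=
  (forall n, (n < m)%N -> derive1n n f x0 = 0) /\ derive1n m f x0 != 0.

Definition vorder (R : realType) (f : R -> R) (x0 : R) : nat :=
  xget 0%N [set m | vanish_order_is f x0 m].

Definition kappa_pos_branch (R : realType) (f : R -> R) (x0 : R) : R :=
  let m := vorder f x0 in
  let eta := Num.sg (derive1n m f x0) in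
  if odd m then (m%:R + eta) / 2 else m%:R / 2.
Definition kappa_neg_branch (R : realType) (f : R -> R) (x0 : R) : R :=
  let m := vorder f x0 in
  let eta := Num.sg (derive1n m f x0) in
  if odd m then (m%:R - eta) / 2 else m%:R / 2.

Definition kappa_pos (R : realType) (N : nat) (mu : 'I_N -> R -> R) (x0 : R) : R :=
  \sum_(i < N | mu i x0 == 0) kappa_pos_branch (mu i) x0.
Definition kappa_neg (R : realType) (N : nat) (mu : 'I_N -> R -> R) (x0 : R) : R :=
  \sum_(i < N | mu i x0 == 0) kappa_neg_branch (mu i) x0.
Definition kappa (R : realType) (N : nat) (mu : 'I_N -> R -> R) (x0 : R) : R :=
  kappa_pos mu x0 - kappa_neg mu x0.

(* Main.v *)
Require Import Defs.
From HB Require Import structures.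
From mathcomp Require Import all_boot all_order all_algebra.
From mathcomp Require Import all_classical all_reals all_analysis.
From mathcomp Require Import complex.
From mathcomp Require Import ring lra zify.
Import Order.TTheory GRing.Theory Num.Theory.
Import numFieldNormedType.Exports.
Local Open Scope ring_scope.
Local Open Scope classical_set_scope.

(* For a branch mu and a point x, let s(x+) and s(x-) be the signs of mu just
   to the right and just to the left of x.  The power series of mu at x shows
   that the contribution of mu to kappa(x) is (s(x+) - s(x-)) / 2, so the sum
   of kappa over ]a, b[ telescopes to half the sum over the branches of
   s(b-) - s(a+).  At 0 these signs are counted by N_-(L_0) and Z.  At
   infinity the eigenvalues y^p mu(1/y) of y^p L(1/y) are bounded as y -> 0,
   hence converge along an ultrafilter to the nonzero eigenvalues of L_p, so
   the signs are counted by N_-(L_p) and, at -oo since p is odd, by N_+(L_p).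
   The inequalities follow because L(x) is diagonalizable, so |kappa(x)| is at
   most the number of branches vanishing at x, which is at most dim ker L(x). *)

Set Implicit Arguments.
Unset Strict Implicit.
Unset Printing Implicit Defensive.

(** * Power series *)

(** With [|z| < t < |x|] and [s = |z| / t], the factor [n.+1] brought in by differentiation is
    absorbed by [n.+1 * s ^+ n <= (1 - s)^-1], so a multiple of the series of [|c k| * t ^+ k]
    dominates. *)
Lemma is_cvg_pseries_diffs (R : realType) (c : nat -> R) (x z : R) :
  cvgn (pseries c x) -> `|z| < `|x| -> cvgn (pseries (pseries_diffs c) z).
Proof.
move=> cx zx; pose t := (`|z| + `|x|) / 2.
have t0 : 0 < t by rewrite /t; have := normr_ge0 z; lra.
have zt : `|z| < t by rewrite /t; lra.
have tx : `|t| < `|x| by rewrite gtr0_norm // /t; lra.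
pose s := `|z| / t.
have s0 : 0 <= s by rewrite divr_ge0 // ltW.
have s1 : s < 1 by rewrite ltr_pdivrMr // mul1r.
(* s ^+ n is the smallest term of the geometric sum 1 + s + ... + s ^+ n *)
have key n : n.+1%:R * s ^+ n <= (1 - s)^-1.
  apply: (@le_trans _ _ (\sum_(i < n.+1) s ^+ i)).
    rewrite -{1}(card_ord n.+1) mulr_natl -sumr_const ler_sum // => i _.
    by rewrite ler_wiXn2l // ?ltW // -ltnS.
  rewrite -[leRHS]mul1r ler_pdivlMr ?subr_gt0 // mulrC.
  by rewrite -[1 - s]opprB mulNr -subrX1 opprB gerBl exprn_ge0.
have ct : cvgn (series (fun k => ((1 - s)^-1 / t) * (`|c k.+1| * t ^+ k.+1))).
  apply: is_cvg_seriesZ.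
  have := is_cvg_pseries_inside_norm cx tx; rewrite /pseries => H.
  have E n : series (fun k => `|c k.+1| * t ^+ k.+1) n =
     series (fun k => `|c k| * t ^+ k) n.+1 - `|c 0%N|.
    by rewrite /series /= big_nat_recl // expr0 mulr1 addrC addKr.
  rewrite (funext E); apply: is_cvgB; last exact: is_cvg_cst.
  by case/cvg_ex: H => v Hv; apply/cvg_ex; exists v; rewrite (cvg_shiftS (series _)).
apply: normed_cvg; apply: series_le_cvg ct => n //=.
  by rewrite !mulr_ge0 // ?invr_ge0 ?subr_ge0 ?exprn_ge0 // ltW.
rewrite /pseries_diffs !normrM normr_nat normrX.
rewrite (_ : _ * _ * _ = n.+1%:R * s ^+ n / t * (`|c n.+1| * t ^+ n.+1)); last first.
  rewrite /s expr_div_n exprS; field; rewrite expf_neq0 /= ?gt_eqF //.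
apply: ler_wpM2r; first by rewrite mulr_ge0 // exprn_ge0 // ltW.
by apply: ler_wpM2r (key n); rewrite invr_ge0 ltW.
Qed.

Definition has_psum (R : realType) (c : nat -> R) (x0 r : R) (f : R -> R) :=
  forall x, `|x - x0| < r -> pseries c (x - x0) @ \oo --> f x.

Lemma has_psum_is_derive (R : realType) (c : nat -> R) (x0 r : R) (f : R -> R) x :
  has_psum c x0 r f -> `|x - x0| < r ->
  is_derive x 1 f (limn (pseries (pseries_diffs c) (x - x0))).
Proof.
(* [K 1 < K 2 < K 3] are equally spaced strictly between [|x - x0|] and [r]. Termwise
   differentiation requires the first and second derived series, and each derivation costs a passage
   to a smaller radius. *)
move=> cf xr; pose K i := (`|x - x0| * (4 - i) + r * i) / 4.
have n0 := normr_ge0 (x - x0).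
have K0 i : 0 < i < 4 -> [/\ 0 < K i & `|x - x0| < K i < r].
  by move=> /andP[i0 i1]; rewrite /K; split; nra.
have nK i : 0 < i < 4 -> `|K i| = K i by case/K0 => ? _; rewrite gtr0_norm.
have KK i j : 0 < i < 4 -> 0 < j < 4 -> i < j -> `|K i| < `|K j|.
  by move=> ? ? ?; rewrite !nK // /K; nra.
have I1 : 0 < (1 : R) < 4 by apply/andP; split; lra.
have I2 : 0 < (2 : R) < 4 by apply/andP; split; lra.
have I3 : 0 < (3 : R) < 4 by apply/andP; split; lra.
have c3 : cvgn (pseries c (K 3)).
  have := cf (x0 + K 3); rewrite (addrC x0) addrK nK // => H.
  by apply/cvg_ex; exists (f (K 3 + x0)); apply: H; case/K0: I3 => _ /andP[].
have c2 := is_cvg_pseries_diffs c3 (KK _ _ I2 I3 ltac:(lra)).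
have c1 := is_cvg_pseries_diffs c2 (KK _ _ I1 I2 ltac:(lra)).
have Kx : `|x - x0| < `|K 1| by rewrite nK //; case/K0: I1 => _ /andP[].
have [D E] := pseries_snd_diffs (is_cvg_pseries_inside c3 (KK _ _ I1 I3 ltac:(lra)))
 (is_cvg_pseries_inside c2 (KK _ _ I1 I2 ltac:(lra))) c1 Kx.
have G : is_derive (x - x0) (1 : R) (fun y => limn (pseries c y))
  (limn (pseries (pseries_diffs c) (x - x0))).
  by constructor.
have H : is_derive x (1 : R) (fun y => y - x0) 1.
  by rewrite -[X in is_derive _ _ _ X]subr0; apply: is_deriveB.
have := @is_derive1_comp _ (fun y => limn (pseries c y)) (fun y => y - x0) _ _ _ G H.
rewrite mulr1; apply: near_eq_is_derive.
near=> y; rewrite /=; apply/cvg_lim => //; apply: cf.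
have -> : y - x0 = (y - x) + (x - x0) by ring.
apply: le_lt_trans (ler_normD _ _) _.
rewrite -ltrBrDr distrC; near: y; apply: nbhsx_ballx; rewrite ?subr_gt0 //.
Unshelve. all: by end_near. Qed.

(** The open disc does not shrink: beyond each of its points there is still a larger radius inside,
    the midpoint [h], at which the previous series converges. *)
Lemma has_psum_derive1n (R : realType) (c : nat -> R) (x0 r : R) (f : R -> R) n :
  has_psum c x0 r f -> has_psum (iter n (@pseries_diffs R) c) x0 r (derive1n n f).
Proof.
elim: n => [//|n IH] cf x xr.
have [_ D] := has_psum_is_derive (IH cf) xr.
rewrite derive1nS derive1E D iterS.
have n0 := normr_ge0 (x - x0); pose h := (`|x - x0| + r) / 2.
have hE : `|h| = h by rewrite ger0_norm /h //; lra.
apply: (@is_cvg_pseries_diffs R _ h); last by rewrite hE /h; lra.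
have := IH cf (x0 + h); rewrite (addrC x0) addrK => H.
by apply/cvg_ex; eexists; apply: H; rewrite hE /h; lra.
Qed.

Lemma has_psum_center (R : realType) (c : nat -> R) (x0 r : R) (f : R -> R) :
  0 < r -> has_psum c x0 r f -> f x0 = c 0%N.
Proof.
move=> r0 cf; have := cf x0; rewrite subrr normr0 => /(_ r0) H.
apply: (cvg_unique _ H) => //=; rewrite -(cvg_shiftS (pseries c 0)).
apply: cvg_near_cst; near=> n; rewrite /= /pseries /series /=.
rewrite big_nat_recl // expr0 mulr1 big1 ?addr0 // => i _.
by rewrite exprS mul0r mulr0.
Unshelve. all: by end_near. Qed.

Lemma iter_pseries_diffs (R : realType) (c : nat -> R) n k :
  iter n (@pseries_diffs R) c k = ((n + k) ^_ n)%N%:R * c (n + k)%N.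
Proof.
elim: n c k => [|n IH] c k; first by rewrite mul1r.
rewrite iterSr IH /pseries_diffs addSn ffactSS mulnC natrM mulrCA mulrA.
by rewrite [_%:R * _%:R]mulrC.
Qed.

Lemma derive1n_has_psum (R : realType) (c : nat -> R) (x0 r : R) (f : R -> R) n :
  0 < r -> has_psum c x0 r f -> derive1n n f x0 = n`!%:R * c n.
Proof.
move=> r0 cf; rewrite (has_psum_center r0 (has_psum_derive1n (n := n) cf)).
by rewrite iter_pseries_diffs addn0 ffactnn.
Qed.

Lemma has_psum_factor (R : realType) (c : nat -> R) (x0 r : R) (f : R -> R) :
  has_psum c x0 r f -> c 0%N = 0 ->
  exists2 g, has_psum (c \o S) x0 r g & forall x, `|x - x0| < r -> f x = (x - x0) * g x.
Proof.
move=> cf c0; pose g x := limn (pseries (c \o S) (x - x0)).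
have E x n : pseries c (x - x0) n.+1 = (x - x0) * pseries (c \o S) (x - x0) n.
  rewrite /pseries /series /= big_nat_recl // c0 mul0r add0r mulr_sumr.
  by apply: eq_bigr => i _; rewrite exprS mulrCA.
have cg x : `|x - x0| < r -> cvgn (pseries (c \o S) (x - x0)).
  move=> xr; have [->|x0N] := eqVneq x x0.
    rewrite subrr; apply/cvg_ex; exists (c 1%N); rewrite -cvg_shiftS.
    apply: cvg_near_cst; near=> n; rewrite /= /pseries /series /=.
    rewrite big_nat_recl // expr0 mulr1 big1 ?addr0 // => i _.
    by rewrite exprS mul0r mulr0.
  have -> : pseries (c \o S) (x - x0) = (fun n => (x - x0)^-1 * pseries c (x - x0) n.+1).
    by apply/funext => n; rewrite E mulKf // subr_eq0.
  apply: is_cvgMl_tmp.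
  by apply/cvg_ex; exists (f x); rewrite (cvg_shiftS (pseries _ _)); apply: cf.
exists g; first by move=> x xr; exact: cg.
move=> x xr; apply: (@cvg_unique _ _ (pseries c (x - x0) @ \oo)) => //=; first exact: cf.
rewrite -(cvg_shiftS (pseries _ _))
  [X in X @ \oo](_ : _ = fun n => (x - x0) * pseries (c \o S) (x - x0) n).
  by apply: cvgMl_tmp; exact: cg.
by apply/funext => n; exact: E.
Unshelve. all: by end_near. Qed.

Lemma continuous_near_sg (R : realType) (f : R -> R) (x0 : R) :
  {for x0, continuous f} -> f x0 != 0 -> \forall y \near x0, Num.sg (f y) = Num.sg (f x0).
Proof.
move=> cf; case: (ltrgt0P (f x0)) => // s _.
- near=> y; rewrite !gtr0_sg //; near: y.
  exact: (cvgr_gt _ cf).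
- near=> y; rewrite !ltr0_sg //; near: y.
  exact: (cvgr_lt _ cf).
Unshelve. all: by end_near. Qed.

(** Induction on the order [m]: a zero constant coefficient lets a factor [x - x0] be split off, and
    a nonzero one gives the sign by continuity. The power of [Num.sg (y - x0)] treats both sides at
    once. *)
Lemma has_psum_sg (R : realType) (c : nat -> R) (x0 r : R) (f : R -> R) m :
  0 < r -> has_psum c x0 r f -> (forall k, (k < m)%N -> c k = 0) -> c m != 0 ->
  \forall y \near x0^', Num.sg (f y) = Num.sg (y - x0) ^+ m * Num.sg (c m).
Proof.
move=> r0; elim: m c f => [|m IH] c f cf cm0 cm.
  have f0 := has_psum_center r0 cf.
  near=> y; rewrite expr0 mul1r -f0; near: y.
  apply: cvg_within; apply: continuous_near_sg; last by rewrite f0.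
  have [D _] := @has_psum_is_derive _ _ _ _ _ x0 cf ltac:(by rewrite subrr normr0).
  exact/differentiable_continuous/derivable1_diffP.
have [g cg fg] := has_psum_factor cf (cm0 0%N isT).
near=> y; rewrite fg ?sgrM; last first.
  near: y; apply: cvg_within; rewrite /=.
  have := @nbhsx_ballx R R x0 r r0; apply: filterS => y.
  by rewrite /ball /= distrC.
rewrite exprS -mulrA; congr (_ * _); near: y.
exact: (IH _ _ cg (fun k km => cm0 k.+1 km) cm).
Unshelve. all: by end_near. Qed.

(** * One-sided signs of analytic functions *)

Lemma real_analytic_continuous (R : realType) (f : R -> R) :
  real_analytic f -> continuous f.
Proof.
move=> fa x; have [r [r0 [c cf]]] := fa x.
have [D _] := @has_psum_is_derive _ c x r f x cf ltac:(by rewrite subrr normr0).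
exact/differentiable_continuous/derivable1_diffP.
Qed.

(* The signs of f just to the right and just to the left of x, provided f is
   analytic and not identically zero near x (near_sright, near_sleft). *)
Definition sright (R : realType) (f : R -> R) (x : R) : R :=
  Num.sg (derive1n (vorder f x) f x).
Definition sleft (R : realType) (f : R -> R) (x : R) : R :=
  (-1) ^+ vorder f x * sright f x.

(** For even order both signatures are [m / 2] and the one-sided signs agree; for odd order the
    signatures differ by [eta] and the signs are opposite. *)
Lemma kappa_branch_jump (R : realType) (f : R -> R) (x : R) :
  kappa_pos_branch f x - kappa_neg_branch f x = (sright f x - sleft f x) / 2.
Proof.
rewrite /kappa_pos_branch /kappa_neg_branch /sleft -signr_odd -/(sright f x).
by case: ifP => _; rewrite ?expr1 ?expr0; field.
Qed.

Lemma vorderP (R : realType) (f : R -> R) (x m : _) :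
  vanish_order_is f x m -> vorder f x = m.
Proof.
move=> fm; apply: xget_unique => // k [fk0 fk]; case: fm => fm0 fm.
case: (ltngtP k m) => // km.
  by move: fk; rewrite fm0 // eqxx.
by move: fm; rewrite fk0 // eqxx.
Qed.

(** Since the [n]-th derivative at [x] is [n! * c n], the vanishing order is the index of the first
    nonzero Taylor coefficient. *)
Lemma near_sg_vorder (R : realType) (f : R -> R) (x : R) :
  real_analytic f -> (\forall y \near x^', f y != 0) ->
  \forall y \near x^', Num.sg (f y) = Num.sg (y - x) ^+ vorder f x * sright f x.
Proof.
move=> fa fn0; have [r [r0 [c cf]]] := fa x.
have dE n := derive1n_has_psum n r0 cf.
(* If all coefficients vanished, [f] would be zero near [x], against the hypothesis on the punctured
   neighbourhood. *)
have [[m cm]|c0] := pselect (exists m, c m != 0); last first.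
  have: \forall y \near x^', False.
    near=> y; have : f y != 0 by near: y.
    suff -> : f y = 0 by rewrite eqxx.
    have yr : `|y - x| < r.
      near: y; apply: cvg_within => /=.
      have := @nbhsx_ballx R R x r r0; apply: filterS => y.
      by rewrite /ball /= distrC.
    apply: (@cvg_unique _ _ (pseries c (y - x) @ \oo)) => //=; first exact: cf.
    apply: cvg_near_cst; near=> n; rewrite /pseries /series /= big1 // => i _.
    by have [->|ci] := eqVneq (c i) 0; [rewrite mul0r|case: c0; exists i].
  by move/filter_ex => [].
have exc : exists m, c m != 0 by exists m.
have cmin := ex_minnP exc; case: cmin => {cm}m cm cmin.
have ck k : (k < m)%N -> c k = 0.
  by move=> km; apply/eqP; apply: contraTT km => /cmin; rewrite -leqNgt.
have vm : vorder f x = m.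
  apply: vorderP; split=> [k km|]; first by rewrite dE ck // mulr0.
  by rewrite dE mulf_neq0 // pnatr_eq0 -lt0n fact_gt0.
rewrite vm /sright vm dE sgrM gtr0_sg ?ltr0n ?fact_gt0 // mul1r.
exact: has_psum_sg r0 cf ck cm.
Unshelve. all: by end_near. Qed.

Lemma near_at_right (R : realType) (x : R) (P : R -> Prop) :
  (\forall y \near x^', P y) -> \forall y \near x^'+, P y.
Proof.
rewrite !near_withinE => H; near=> y => xy.
by apply: (near H y) => //; rewrite gt_eqF.
Unshelve. all: by end_near. Qed.

Lemma near_at_left (R : realType) (x : R) (P : R -> Prop) :
  (\forall y \near x^', P y) -> \forall y \near x^'-, P y.
Proof.
rewrite !near_withinE => H; near=> y => xy.
by apply: (near H y) => //; rewrite lt_eqF.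
Unshelve. all: by end_near. Qed.

Lemma big_itv_split (R : realType) (V : nmodType) (a b c : R) (s : seq R) (F : R -> V) :
  uniq s -> c \in s -> a < c < b ->
  \sum_(x <- s | a < x < b) F x =
  \sum_(x <- s | a < x < c) F x + F c + \sum_(x <- s | c < x < b) F x.
Proof.
move=> us cs /andP[ac cb].
have -> : F c = \sum_(x <- s | x == c) F x by rewrite -big_filter filter_pred1_uniq // big_seq1.
rewrite big_mkcond [X in _ = X + _ + _]big_mkcond [X in _ = _ + X + _]big_mkcond.
rewrite [X in _ = _ + X]big_mkcond -!big_split; apply: eq_bigr => x _ /=.
case: (ltrgtP x c) => [xc|cx|->]; last by rewrite ac cb !andbF add0r addr0.
  by rewrite (lt_trans xc cb) !addr0.
by rewrite (lt_trans ac cx) andbF !add0r.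
Qed.

(** * Telescoping the jumps of one branch *)

Section Branch.
Variables (R : realType) (f : R -> R) (zs : seq R).
Hypotheses (fa : real_analytic f) (fz : forall x, f x = 0 -> x \in zs).

Lemma near_dnbhs_neq0 x : \forall y \near x^', f y != 0.
Proof.
have : \forall y \near x^', y \notin zs.
  elim: zs => [|z s IH]; first by near=> y.
  have zN : \forall y \near x^', y != z.
    have [->|] := eqVneq z x; first exact: nbhs_dnbhs_neq.
    rewrite neq_lt => /orP[zx|xz]; apply: cvg_within.
      by near do rewrite gt_eqF //; exact: lt_nbhsr.
    by near do rewrite lt_eqF //; exact: lt_nbhsl.
  near=> y; rewrite inE negb_or; apply/andP; split; near: y; [exact: zN|exact: IH].
by apply: filterS => y; apply: contra => /eqP/fz.
Unshelve. all: by end_near. Qed.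

Lemma near_sright x : \forall y \near x^'+, Num.sg (f y) = sright f x.
Proof.
have := near_sg_vorder fa (near_dnbhs_neq0 x) => H.
near=> y; have -> : Num.sg (f y) = Num.sg (y - x) ^+ vorder f x * sright f x.
  by near: y; apply: near_at_right; exact: H.
by rewrite gtr0_sg ?expr1n ?mul1r // subr_gt0.
Unshelve. all: by end_near. Qed.

Lemma near_sleft x : \forall y \near x^'-, Num.sg (f y) = sleft f x.
Proof.
have := near_sg_vorder fa (near_dnbhs_neq0 x) => H.
near=> y; have -> : Num.sg (f y) = Num.sg (y - x) ^+ vorder f x * sright f x.
  by near: y; apply: near_at_left; exact: H.
by rewrite ltr0_sg // subr_lt0.
Unshelve. all: by end_near. Qed.

Lemma sright_neq0 x : sright f x != 0.
Proof.
have : \forall y \near x^'+, sright f x != 0.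
  near=> y; have <- : Num.sg (f y) = sright f x by near: y; exact: near_sright.
  rewrite sgr_eq0; near: y; apply: near_at_right; exact: near_dnbhs_neq0.
by case/filter_ex.
Unshelve. all: by end_near. Qed.

Lemma vorder_neq0 x : f x != 0 -> vorder f x = 0%N.
Proof. by move=> fx; apply: vorderP; split. Qed.

Lemma sright_sg x : f x != 0 -> sright f x = Num.sg (f x).
Proof. by move=> fx; rewrite /sright vorder_neq0. Qed.

Lemma sleft_sg x : f x != 0 -> sleft f x = Num.sg (f x).
Proof. by move=> fx; rewrite /sleft sright_sg // vorder_neq0 // mul1r. Qed.

Lemma sg_const a b : a <= b -> (forall x, a <= x <= b -> f x != 0) ->
  Num.sg (f a) = Num.sg (f b).
Proof.
move=> ab nz; apply/eqP; apply: contraT => ne.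
have fa0 : f a != 0 by rewrite nz // lexx.
have fb0 : f b != 0 by rewrite nz // lexx andbT.
have [|c] := @IVT R f a b 0 ab (continuous_subspaceT (real_analytic_continuous fa)).
  move: ne; case: (ltrgt0P (f a)) fa0 => // sa _; case: (ltrgt0P (f b)) fb0 => // sb _.
  - by rewrite !gtr0_sg ?eqxx.
  - by move=> _; rewrite ge_min le_max (ltW sa) (ltW sb) ?orbT.
  - by move=> _; rewrite ge_min le_max (ltW sa) (ltW sb) ?orbT.
  - by rewrite !ltr0_sg ?eqxx.
by rewrite in_itv /= => /nz/eqP.
Qed.

(** Induction on the number of listed points in the interval: cutting at one of them cancels the
    intermediate signs, and without any the sign of [f] is constant inside. The endpoints may be
    zeros themselves, hence the one-sided signs. *)
Lemma sum_jump a b : uniq zs -> a < b ->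
  \sum_(x <- zs | a < x < b) (sright f x - sleft f x) = sleft f b - sright f a.
Proof.
move=> uz; have [n] := ubnP (count (fun x => a < x < b) zs).
elim: n a b => // n IH a b; rewrite ltnS => cn ab.
have [/hasP[c cz /andP[ac cb]]|/hasPn nh] := boolP (has (fun x => a < x < b) zs).
  have cE : count (fun x => a < x < b) zs = (count (fun x => (a < x < c)%R) zs
      + 1 + count (fun x => (c < x < b)%R) zs)%N.
    rewrite -!sum1_count. apply: (big_itv_split _ uz cz). by rewrite ac.
  rewrite (big_itv_split _ uz cz) ?ac // !IH //; [ring| |]; move: cn; rewrite cE; lia.
rewrite big1_seq ?subr_eq0; last by move=> x /andP[xab /nh]; rewrite xab.
suff /eqP -> : sleft f b == sright f a by rewrite subrr.
(* Both sides are constants, so it suffices to compare them at one [y] near [a] and one [z] near [b]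
   with [y < z]. *)
have : \forall y \near a^'+, sleft f b == sright f a.
  near=> y; have <- : Num.sg (f y) = sright f a by near: y; exact: near_sright.
  have ya : a < y by [].
  have yb : y < b by near: y; exact: nbhs_right_lt.
  have : \forall z \near b^'-, sleft f b == Num.sg (f y).
    near=> z; have <- : Num.sg (f z) = sleft f b by near: z; exact: near_sleft.
    have zb : z < b by [].
    have yz : y < z by near: z; exact: nbhs_left_gt.
    apply/eqP/esym/sg_const; first exact: ltW.
    move=> x /andP[yx xz]; apply/eqP => /fz/nh.
    by move=> /negP; apply; rewrite (lt_le_trans ya yx) (le_lt_trans xz zb).
  by case/filter_ex.
by case/filter_ex.
Unshelve. all: by end_near. Qed.
End Branch.

(** * Eigenvalue counts *)

Lemma horner_char_poly (K : comNzRingType) n (A : 'M[K]_n) t :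
  (char_poly A).[t] = \det (t%:M - A).
Proof.
rewrite -[LHS]/(horner_eval t _) -det_map_mx; congr (\det _).
apply/matrixP => i j; rewrite !mxE.
by rewrite /= /horner_eval hornerD hornerN hornerMn hornerX hornerC.
Qed.

(** The naturals are infinitely many distinct evaluation points. This reduces equalities of
    characteristic polynomials to equalities of determinants over the field. *)
Lemma poly_nat_eq (K : numDomainType) (p q : {poly K}) :
  (forall n : nat, p.[n%:R] = q.[n%:R]) -> p = q.
Proof.
move=> pq; apply/eqP; rewrite -subr_eq0; apply: contraT => pq0.
have := @max_poly_roots _ (p - q) [seq n%:R | n <- iota 0 (size (p - q))] pq0.
rewrite size_map size_iota ltnn; apply.
  by apply/allP => _ /mapP[n _ ->]; rewrite rootE !hornerE pq subrr.
rewrite map_inj_uniq ?iota_uniq // => m n /eqP; rewrite eqr_nat => /eqP; exact.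
Qed.

Lemma char_poly_scale (K : fieldType) n (A : 'M[K]_n) (a : 'I_n -> K) (c t : K) :
  c != 0 -> char_poly A = \prod_i ('X - (a i)%:P) ->
  (char_poly (c *: A)).[t] = \prod_i (t - c * a i).
Proof.
move=> c0 Aa; have : (char_poly A).[t / c] = \prod_i (t / c - a i).
  by rewrite Aa horner_prod; apply: eq_bigr => i _; rewrite !hornerE.
rewrite !horner_char_poly => E.
have -> : t%:M - c *: A = c *: ((t / c)%:M - A).
  by rewrite scalerBr scale_scalar_mx mulrCA mulfV ?mulr1.
rewrite detZ E -[X in c ^+ X]card_ord -prodr_const -big_split /=.
by apply: eq_bigr => i _; rewrite mulrBr mulrCA mulfV ?mulr1.
Qed.

Lemma det_prod_roots (K : comNzRingType) n (A : 'M[K]_n) (a : 'I_n -> K) :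
  char_poly A = \prod_i ('X - (a i)%:P) -> \det A = \prod_i a i.
Proof.
move=> Aa; have := char_poly_det A.
rewrite -horner_coef0 Aa horner_prod => E.
apply: (inv_inj (signrMK n)); rewrite -E.
rewrite -[X in (-1) ^+ X]card_ord -prodr_const -big_split /=.
by apply: eq_bigr => i _; rewrite !hornerE mulN1r.
Qed.

Lemma eigenvalues_perm (R : realType) n (A : 'M[R[i]]_n) (a : 'I_n -> R) :
  char_poly A = \prod_i ('X - (rC (a i))%:P) ->
  perm_eq (eigenvalues A) [seq rC (a i) | i <- index_enum 'I_n].
Proof.
move=> Aa; apply: prod_XsubC_eq; rewrite big_map -Aa /eigenvalues.
case: closed_field_poly_normal => /= s ->.
by rewrite (monicP (char_poly_monic A)) scale1r.
Qed.

Lemma Npos_mxE (R : realType) n (A : 'M[R[i]]_n) (a : 'I_n -> R) :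
  char_poly A = \prod_i ('X - (rC (a i))%:P) ->
  Npos_mx A = #|[pred i | 0 < a i]|.
Proof.
move=> /eigenvalues_perm/permP E; rewrite /Npos_mx E count_map.
rewrite -sum1_card -sum1_count; apply: eq_big => // i.
by rewrite /= inE (ltcR 0 (a i)).
Qed.

Lemma Nneg_mxE (R : realType) n (A : 'M[R[i]]_n) (a : 'I_n -> R) :
  char_poly A = \prod_i ('X - (rC (a i))%:P) ->
  Nneg_mx A = #|[pred i | a i < 0]|.
Proof.
move=> /eigenvalues_perm/permP E; rewrite /Nneg_mx E count_map.
rewrite -sum1_card -sum1_count; apply: eq_big => // i.
by rewrite /= inE (ltcR (a i) 0).
Qed.

Lemma mxrank_sum_le (K : fieldType) m n I (s : seq I) (A : I -> 'M[K]_(m, n)) :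
  (\rank (\sum_(i <- s) A i)%R <= \sum_(i <- s) \rank (A i))%N.
Proof.
elim: s => [|i s IH]; first by rewrite !big_nil mxrank0.
by rewrite !big_cons; apply: leq_trans (mxrank_add _ _) _; rewrite leq_add2l.
Qed.

Lemma rank_diag_mx_le (K : fieldType) n (d : 'rV[K]_n) :
  (\rank (diag_mx d) <= #|[pred i | d 0%R i != 0%R]|)%N.
Proof.
have -> : diag_mx d = \sum_i d 0 i *: delta_mx i i.
  apply/matrixP => i j; rewrite mxE summxE (bigD1 i) //= big1 => [|k ki].
    by rewrite !mxE eqxx addr0 /= mulr_natr eq_sym.
  by rewrite !mxE eq_sym (negPf ki) mulr0.
apply: leq_trans (mxrank_sum_le _ _) _; rewrite -sum1_card [leqRHS]big_mkcond.
apply: leq_sum => i _.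
rewrite inE; have [->|di] := eqVneq (d 0 i) 0.
  by rewrite scale0r mxrank0.
by rewrite mxrank_scale_nz // mxrank_delta.
Qed.

(** By the spectral theorem [A] is similar to a diagonal matrix, whose rank is at most its number of
    nonzero entries; the characteristic polynomial identifies these entries with the [a i] up to
    order. *)
Lemma hermitian_rank_le (R : realType) n (A : 'M[R[i]]_n) (a : 'I_n -> R) :
  hermitian_mx A -> char_poly A = \prod_i ('X - (rC (a i))%:P) ->
  (#|[pred i | a i == 0%R]| <= n - \rank A)%N.
Proof.
move=> hA Aa.
have /orthomx_spectralP : A \is normalmx.
  apply: hermitian_normalmx; apply/is_hermitianmxP.
  by rewrite expr0 scale1r [RHS]hA.
set P := spectralmx A; set d := spectral_diag A => AE.
have Pu : P \in unitmx := spectral_unit A.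
have rA : (\rank A <= #|[pred i | d 0%R i != 0%R]|)%N.
  rewrite AE -mulmxA; apply: leq_trans (mxrankM_maxr _ _) _.
  by apply: leq_trans (mxrankM_maxl _ _) _; exact: rank_diag_mx_le.
have dE : char_poly A = \prod_i ('X - (d 0 i)%:P).
  have dT : char_poly (diag_mx d) = \prod_i ('X - (d 0 i)%:P).
    rewrite char_poly_trig ?diag_mx_is_trig //.
    by apply: eq_bigr => i _; rewrite mxE eqxx mulr1n.
  (* Similar matrices have the same characteristic polynomial, checked at each natural number. *)
  rewrite -dT; apply: poly_nat_eq => k; rewrite !horner_char_poly.
  have -> : k%:R%:M - A = invmx P *m (k%:R%:M - diag_mx d) *m P.
    by rewrite mulmxBr mulmxBl -AE mul_mx_scalar -scalemxAl mulVmx // scalemx1.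
  by rewrite !det_mulmx mulrAC -det_mulmx mulVmx // det1 mul1r.
have /permP E : perm_eq [seq d 0 i | i <- index_enum 'I_n] [seq rC (a i) | i <- index_enum 'I_n].
  by apply: prod_XsubC_eq; rewrite !big_map -dE.
have cE : #|[pred i | a i == 0%R]| = #|[pred i | d 0%R i == 0%R]|.
  have := E (pred1 0); rewrite !count_map -!sum1_count -!sum1_card => H.
  transitivity (\sum_(j | preim (fun i => rC (a i)) (pred1 0%R) j) 1)%N.
    apply: eq_bigl => i; rewrite inE /=.
    by rewrite -(inj_eq (@complexI R)).
  by rewrite -H; apply: eq_bigl => i; rewrite inE.
rewrite cE -(leq_add2r (\rank A)) subnK ?rank_leq_row //.
apply: leq_trans (leq_add (leqnn _) rA) _.
rewrite -[X in (_ <= X)%N](card_ord n) -(cardC [pred i | d 0%R i == 0%R]) leq_add2l.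
by apply: subset_leq_card; apply/fintype.subsetP => i; rewrite !inE.
Qed.

(** * The reversed pencil *)

(** For a row eigenvector [v], compare the sums of the moduli of the entries on both sides of
    [a v = v A]. This crude bound serves to keep the eigenvalues bounded near infinity. *)
Lemma eigenvalue_norm_le (K : numFieldType) n (A : 'M[K]_n) a :
  root (char_poly A) a -> `|a| <= \sum_i \sum_j `|A i j|.
Proof.
rewrite -eigenvalue_root_char => /eigenvalueP[v vA v0].
have s0 : 0 < \sum_j `|v 0 j|.
  rewrite lt_def sumr_ge0 // andbT; apply: contra v0; rewrite psumr_eq0 //.
  move=> /allP v0; apply/eqP/rowP => j; apply/eqP.
  by rewrite mxE -normr_eq0; exact: v0 (mem_index_enum j).
rewrite -(ler_pM2r s0) mulr_sumr.
apply: (@le_trans _ _ (\sum_j \sum_i `|v 0 i| * `|A i j|)).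
  apply: ler_sum => j _; rewrite -normrM.
  have -> : a * v 0 j = \sum_i v 0 i * A i j.
    by move/rowP: vA => /(_ j); rewrite !mxE => ->.
  by apply: le_trans (ler_norm_sum _ _ _) _; apply: ler_sum => i _; rewrite normrM.
rewrite exchange_big mulr_sumr; apply: ler_sum => i _.
rewrite -mulr_sumr mulrC ler_wpM2r // [leRHS](bigD1 i) //= lerDl.
by apply: sumr_ge0 => k _; apply: sumr_ge0.
Qed.

(** By compactness of the segment the image filter has a cluster point, and an ultrafilter converges
    to its cluster points. *)
Lemma ultra_bounded_cvg (R : realType) T (G : set_system T) (f : T -> R) (C : R) :
  UltraFilter G -> (\forall x \near G, `|f x| <= C) ->
  exists r : R, f x @[x --> G] --> r.
Proof.
move=> UG fC; have PG : ProperFilter G := ultra_proper.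
have [|r [_ rc]] := @segment_compact R (- C) C (f @ G) (fmap_proper_filter _ _).
  by near=> x; rewrite /= in_itv /= -ler_norml; near: x.
exists r => U Ur; have [//|GU] := in_ultra_setVsetC (f @^-1` U) UG.
have [|x [/= + Ux]] := rc (~` U) U _ Ur; last by [].
exact: GU.
Unshelve. all: by end_near. Qed.

Lemma cvg_prodr (R : realType) T (G : set_system T) (I : Type) (s : seq I)
    (f : I -> T -> R) (a : I -> R) : Filter G ->
  (forall i, f i x @[x --> G] --> a i) ->
  \prod_(i <- s) f i x @[x --> G] --> \prod_(i <- s) a i.
Proof.
move=> FG fa; elim: s => [|i s IH].
  by rewrite big_nil; under eq_cvg do rewrite big_nil; exact: cvg_cst.
by rewrite big_cons; under eq_cvg do rewrite big_cons; exact: cvgM.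
Qed.

(** Splitting into real polynomials lets limits be taken with real continuity. *)
Lemma horner_rC (R : realType) (E : {poly R[i]}) :
  exists e1 e2 : {poly R}, forall y, E.[rC y] = Complex e1.[y] e2.[y].
Proof.
elim/poly_ind: E => [|E c [e1 [e2 IH]]].
  by exists 0, 0 => y; rewrite !horner0.
exists (e1 * 'X + (complex.Re c)%:P), (e2 * 'X + (complex.Im c)%:P) => y.
rewrite !hornerE IH; case: c => c1 c2 /=; rewrite /rC /=.
by apply/eqP; rewrite eq_complex /=; apply/andP; split; apply/eqP; ring.
Qed.

(* w ^+ p times the pencil at 1 / w, so that w = 0 stands for infinity *)
Definition rev_pencil_at (K : pzRingType) (N p : nat) (L : 'I_p.+1 -> 'M[K]_N)
  (w : K) : 'M[K]_N := \sum_(j < p.+1) w ^+ (p - j) *: L j.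

Lemma rev_pencil_atV (R : realType) (N p : nat) (L : 'I_p.+1 -> 'M[R[i]]_N) w :
  w != 0 -> rev_pencil_at L w = w ^+ p *: pencil_at L w^-1.
Proof.
move=> w0; rewrite /rev_pencil_at /pencil_at scaler_sumr; apply: eq_bigr => j _.
by rewrite scalerA exprVn -expfB_cond // (negPf w0) add0n -ltnS.
Qed.

Lemma rev_pencil_at0 (K : pzRingType) (N p : nat) (L : 'I_p.+1 -> 'M[K]_N) :
  rev_pencil_at L 0 = L ord_max.
Proof.
rewrite /rev_pencil_at (bigD1 ord_max) //= subnn expr0 scale1r big1 ?addr0 // => j jp.
rewrite expr0n subn_eq0 leqNgt (_ : j < p)%N ?scale0r //.
by rewrite ltn_neqAle -ltnS ltn_ord andbT.
Qed.

(** Here [t] is fixed and [w] is the indeterminate: this gives continuity at [w = 0] and, for a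
    nonzero polynomial, finitely many roots. *)
Definition rev_char_poly (K : comNzRingType) (N p : nat) (L : 'I_p.+1 -> 'M[K]_N)
  (t : K) : {poly K} := \det (t%:P%:M - rev_pencil_at (fun j => map_mx polyC (L j)) 'X).

Lemma horner_rev_char_poly (K : comNzRingType) (N p : nat) (L : 'I_p.+1 -> 'M[K]_N) t w :
  (rev_char_poly L t).[w] = (char_poly (rev_pencil_at L w)).[t].
Proof.
rewrite horner_char_poly -[LHS]/(horner_eval w _) -det_map_mx; congr (\det _).
apply/matrixP => i j; rewrite !mxE !summxE rmorphB rmorphMn rmorph_sum /=.
rewrite /horner_eval hornerC; congr (_ - _); apply: eq_bigr => k _.
by rewrite !mxE hornerM hornerXn hornerC.
Qed.

(** * Eigenvalues near infinity *)

Section Limit.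
Variables (R : realType) (N p : nat) (L : 'I_p.+1 -> 'M[R[i]]_N) (mu : 'I_N -> R -> R).
Hypotheses (Lmu : eigen_branches L mu) (Lu : L ord_max \in unitmx).

Let nu i y := y ^+ p * mu i y^-1.

Lemma horner_rev_branches t y : y != 0 ->
  (rev_char_poly L (rC t)).[rC y] = rC (\prod_i (t - nu i y)).
Proof.
move=> y0; have yC : rC y != 0 by rewrite /rC (inj_eq (@complexI R) y 0).
rewrite horner_rev_char_poly rev_pencil_atV // /rC -fmorphV.
rewrite (char_poly_scale _ _ (Lmu.2 y^-1)) ?expf_neq0 // rmorph_prod.
by apply: eq_bigr => i _; rewrite /rC /nu rmorphB rmorphM rmorphXn.
Qed.

(** At 0 the polynomial [Q] is, up to sign, the determinant of the invertible leading coefficient,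
    so it has finitely many roots; nonzero real characteristic values are inverses of such roots. *)
Lemma charval_roots : exists2 zs : seq R, uniq zs &
  forall x, (x \in zs) <-> charval L (rC x).
Proof.
pose Q := rev_char_poly L 0.
have Q0 : Q != 0.
  apply/eqP => Q0; have := horner_rev_char_poly L 0 0; rewrite -/Q Q0 horner0 rev_pencil_at0.
  rewrite horner_char_poly (_ : 0%:M = 0) ?raddf0 // sub0r => /esym/eqP.
  rewrite -scaleN1r detZ mulf_eq0 signr_eq0 /= => /eqP d0.
  by move: Lu; rewrite unitmxE d0 unitr0.
have [s Qs] := closed_field_poly_normal Q.
(* The value 0 is not the inverse of a root and is added by hand. The filter keeps only genuine
   characteristic values, as the real part of a non-real root may produce others. *)
pose zs := undup [seq x <- 0 :: [seq (complex.Re z)^-1 | z <- s] | `[< charval L (rC x) >]].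
exists zs => [|x]; first exact: undup_uniq.
rewrite mem_undup mem_filter; split=> [/andP[/asboolP]//|cx].
apply/andP; split; first exact/asboolP.
have [->|x0] := eqVneq x 0; first by rewrite mem_head.
rewrite inE; apply/orP; right; apply/mapP; exists (rC x^-1); last by rewrite /= invrK.
have xC : rC x^-1 != 0 by rewrite /rC (inj_eq (@complexI R) _ 0) invr_eq0.
rewrite -root_prod_XsubC -(rootZ _ _ (_ : lead_coef Q != 0)) ?lead_coef_eq0 //.
rewrite -Qs rootE horner_rev_char_poly horner_char_poly rev_pencil_atV //.
rewrite (_ : 0%:M = 0) ?raddf0 // sub0r -scaleN1r !detZ /rC fmorphV invrK.
by rewrite [X in _ * (_ * X)]cx !mulr0.
Qed.

(** Along an ultrafilter finer than [F] the bounded [nu i] converge, and the characteristic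
    polynomial passes to the limit. Every set of [F] then contains a point where all [nu i] have the
    signs of their limits. *)
Lemma limit_roots (F : set_system R) : ProperFilter F -> F --> (0 : R) ->
  (\forall y \near F, y != 0) ->
  exists r : 'I_N -> R, [/\ char_poly (L ord_max) = \prod_i ('X - (rC (r i))%:P),
    forall i, r i != 0 &
    forall P, F P -> exists y, P y /\ forall i, Num.sg (nu i y) = Num.sg (r i)].
Proof.
move=> PF F0 Fn0; have [G [UG FG]] := ultraFilterLemma PF.
have PG : ProperFilter G := ultra_proper.
have G0 : G --> (0 : R) by move=> U /F0; exact: FG.
have Gn0 : \forall y \near G, y != 0 by exact: FG.
(* For [|y| < 1] the powers of [y] have modulus at most 1, so [C] bounds the sum of the moduli of
   the entries of the reversed pencil. *)
pose C := \sum_i \sum_j \sum_k `|L k i j|.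
have nuC i : \forall y \near G, `|nu i y| <= complex.Re C.
  near=> y.
  have y0 : y != 0 by near: y.
  have y1 : `|y| < 1.
    near: y; apply: G0; have := @nbhsx_ballx R R 0 1 ltr01; apply: filterS => y.
    by rewrite /ball /= sub0r normrN.
  have rt : root (char_poly (rev_pencil_at L (rC y))) (rC (nu i y)).
    rewrite rootE -horner_rev_char_poly horner_rev_branches //.
    by rewrite (bigD1 i) //= subrr mul0r.
  have le1 : `|rC (nu i y)| <= C.
    apply: le_trans (eigenvalue_norm_le rt) _.
    apply: ler_sum => a _; apply: ler_sum => b _; rewrite summxE.
    apply: le_trans (ler_norm_sum _ _ _) _; apply: ler_sum => k _.
    rewrite mxE normrM ler_piMl // normrX exprn_ile1 //.
    by rewrite /rC normc_def /= expr0n /= addr0 sqrtr_sqr (lecR _ 1) ltW.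
  move: le1; rewrite /rC normc_def /= expr0n /= addr0 sqrtr_sqr lecE /=.
  by case/andP.
have /choice[r rP] : forall i, exists r : R, nu i y @[y --> G] --> r.
  by move=> i; exact: ultra_bounded_cvg (nuC i).
have rE : char_poly (L ord_max) = \prod_i ('X - (rC (r i))%:P).
  apply: poly_nat_eq => n; rewrite horner_prod -rev_pencil_at0 -horner_rev_char_poly.
  have -> : n%:R = rC (n%:R : R) by rewrite /rC rmorph_nat.
  have [e1 [e2 eE]] := horner_rC (rev_char_poly L (rC n%:R)).
  have ce (e : {poly R}) : e.[y] @[y --> G] --> e.[0].
    by apply: (cvg_comp _ _ G0); exact: continuous_horner.
  (* At real [y != 0] the value is a product of real factors, so its imaginary part vanishes; both
     facts persist in the limit. *)
  have H : \forall y \near G, e1.[y] = \prod_i (n%:R - nu i y) /\ e2.[y] = 0.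
    near=> y; have y0 : y != 0 by near: y.
    by have := eE y; rewrite horner_rev_branches // => -[<- <-].
  have E1 : e1.[0] = \prod_i (n%:R - r i).
    apply: (cvg_unique _ (ce e1)) => //=.
    apply: (@cvg_trans _ (\prod_i (n%:R - nu i y) @[y --> G])).
      by apply: near_eq_cvg; near=> y; case: (near H y).
    by apply: cvg_prodr => i; apply: cvgB => //; exact: cvg_cst.
  have E2 : e2.[0] = 0.
    apply: (cvg_unique _ (ce e2)) => //=.
    by apply: cvg_near_cst; near=> y; case: (near H y).
  rewrite (eE 0) E1 E2 -[LHS]/(rC _) /rC rmorph_prod; apply: eq_bigr => i _.
  by rewrite !hornerE rmorphB.
(* The product of the [r i] is the determinant of the leading coefficient. *)
have r0 i : r i != 0.
  apply: contraTN Lu => /eqP ri; rewrite unitmxE (det_prod_roots rE) (bigD1 i) //=.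
  by rewrite ri mul0r unitr0.
exists r; split=> // P FP.
have sgG i : \forall y \near G, Num.sg (nu i y) = Num.sg (r i).
  case: (ltrgt0P (r i)) (r0 i) => // s _.
  - near=> y; rewrite !gtr0_sg //; near: y; exact: (cvgr_gt _ (rP i)).
  - near=> y; rewrite !ltr0_sg //; near: y; exact: (cvgr_lt _ (rP i)).
have sgA : \forall y \near G, forall i, Num.sg (nu i y) = Num.sg (r i).
  exact: filter_forall.
exact: filter_ex (filterI (FG _ FP) sgA).
Unshelve. all: by end_near. Qed.
End Limit.

(** * Sums of signatures *)

Lemma card_sum_mem (I : finType) (A : {pred I}) :
  #|A| = (\sum_i (i \in A))%N.
Proof. by rewrite -sum1_card big_mkcond; apply: eq_bigr => i _; case: (i \in A). Qed.

Lemma in_mem_set_pred (T : Type) (P : pred T) x :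
  (x \in in_set [set y | P y]) = P x.
Proof. exact: asboolb. Qed.

Lemma sum_sg (R : realDomainType) (I : finType) (r : I -> R) :
  (forall i, r i != 0) ->
  \sum_i Num.sg (r i) = #|I|%:R - 2 * #|[pred i | r i < 0]|%:R.
Proof.
move=> r0; rewrite -sum1_card -[X in _ - 2 * X%:R]sum1_card [in X in _ - X]big_mkcond !natr_sum.
rewrite mulr_sumr -sumrB; apply: eq_bigr => i _; rewrite inE.
case: (ltrgt0P (r i)) (r0 i) => // s _; first by rewrite gtr0_sg // mulr0 subr0.
by rewrite ltr0_sg // mulr1 [2]mulr2n opprD addNKr.
Qed.

Lemma card_neg_pos (R : realDomainType) (I : finType) (r : I -> R) :
  (forall i, r i != 0) ->
  (#|[pred i | (r i < 0)%R]| + #|[pred i | (0 < r i)%R]|)%N = #|I|.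
Proof.
move=> r0; rewrite -(cardC [pred i | r i < 0]); congr addn; apply: eq_card => i.
by rewrite !inE -leNgt le_eqVlt eq_sym (negPf (r0 i)).
Qed.

Section Pencil.
Variables (R : realType) (N p : nat) (L : 'I_p.+1 -> 'M[R[i]]_N) (mu : 'I_N -> R -> R).
Hypotheses (hL : forall j, hermitian_mx (L j)) (Lmu : eigen_branches L mu).

Lemma pencil_at_hermitian x : hermitian_mx (pencil_at L (rC x)).
Proof.
rewrite /hermitian_mx /pencil_at; apply/matrixP => a b.
rewrite !mxE !summxE rmorph_sum; apply: eq_bigr => j _ /=.
rewrite !mxE rmorphM rmorphXn /=; congr (_ ^+ _ * _).
  by apply/CrealP; rewrite /rC complex_real.
by have /matrixP/(_ a b) := hL j; rewrite !mxE.
Qed.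

Lemma char_poly_pencil0 : char_poly (L ord0) = \prod_i ('X - (rC (mu i 0))%:P).
Proof.
rewrite -Lmu.2; congr char_poly; rewrite /pencil_at big_ord_recl expr0 scale1r.
by rewrite big1 ?addr0 // => j _; rewrite expr0n scale0r.
Qed.

Lemma charvalP x : charval L (rC x) <-> exists i, mu i x = 0.
Proof.
rewrite /charval (det_prod_roots (Lmu.2 x)); split.
  by move/eqP/prodf_eq0 => [i _ /eqP/(@complexI R _ 0) mi]; exists i.
by move=> [i mi]; rewrite (bigD1 i) //= mi mul0r.
Qed.

(** A branch not vanishing at [x] has equal one-sided signs there, so it adds 0 and the sum may run
    over all branches. *)
Lemma kappa_jump x : kappa mu x = \sum_i (sright (mu i) x - sleft (mu i) x) / 2.
Proof.
rewrite /kappa /kappa_pos /kappa_neg -sumrB big_mkcond; apply: eq_bigr => i _.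
case: eqP => [_|/eqP m0]; first exact: kappa_branch_jump.
by rewrite sright_sg // sleft_sg // subrr mul0r.
Qed.

(** Each vanishing branch contributes -1, 0 or 1, and the number of these branches is the
    multiplicity of the eigenvalue 0 of a Hermitian matrix. *)
Lemma kappa_le_geom_mult x : `|kappa mu x| <= (geom_mult L x)%:R.
Proof.
apply: (@le_trans _ _ #|[pred i | mu i x == 0]|%:R); last first.
  by rewrite ler_nat; apply: (hermitian_rank_le (pencil_at_hermitian x) (Lmu.2 x)).
rewrite /kappa /kappa_pos /kappa_neg -sumrB -sum1_card natr_sum.
apply: le_trans (ler_norm_sum _ _ _) _; apply: ler_sum => i _.
rewrite kappa_branch_jump /sleft /sright -signr_odd.
by case: odd; case: sgrP => _; rewrite ler_norml; apply/andP; split; lra.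
Qed.

Section Zeros.
Variable zs : seq R.
Hypotheses (uzs : uniq zs) (zsP : forall x, x \in zs <-> charval L (rC x)).

Lemma mu_zeros i x : mu i x = 0 -> x \in zs.
Proof. by move=> mi; apply/zsP/charvalP; exists i. Qed.

Lemma fsum_charval (V : nmodType) (P : pred R) (F : R -> V) :
  \sum_(x \in [set x : R | P x /\ charval L (rC x)]) F x = \sum_(x <- zs | P x) F x.
Proof.
suff -> : [set x : R | P x /\ charval L (rC x)] = [set` [seq x <- zs | P x]].
  by rewrite -fsbig_seq ?filter_uniq // big_filter.
apply/seteqP; split=> x /=.
  by move=> [Px /zsP xz]; rewrite mem_filter Px.
by rewrite mem_filter => /andP[Px /zsP].
Qed.

Lemma sum_kappa a b : a < b ->
  \sum_(x <- zs | a < x < b) kappa mu x =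
  (\sum_i sleft (mu i) b - \sum_i sright (mu i) a) / 2.
Proof.
move=> ab; rewrite (eq_bigr _ (fun x _ => kappa_jump x)) exchange_big /= -sumrB mulr_suml.
apply: eq_bigr => i _; rewrite -mulr_suml.
by rewrite (sum_jump (Lmu.1 i) (@mu_zeros i) uzs ab).
Qed.

Lemma norm_sum_kappa_le (P : pred R) :
  `|\sum_(x <- zs | P x) kappa mu x| <= (\sum_(x <- zs | P x) geom_mult L x)%:R.
Proof.
rewrite natr_sum; apply: le_trans (ler_norm_sum _ _ _) _.
by apply: ler_sum => x _; exact: kappa_le_geom_mult.
Qed.

(** * Signs of the branches at zero and at infinity *)

Let sneq0 i : sright (mu i) 0 != 0 := sright_neq0 (Lmu.1 i) (@mu_zeros i) 0.

(** The right sign at 0 is negative in two disjoint cases: [mu i 0 < 0], counted by [Nneg_mx], and a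
    branch leaving 0 downwards, counted by [Zdown_pos]. *)
Lemma sum_sright0 : \sum_i sright (mu i) 0 =
  N%:R - 2 * ((Nneg_mx (L ord0))%:R + (Zdown_pos mu)%:R).
Proof.
have -> : \sum_i sright (mu i) 0 = \sum_i Num.sg (sright (mu i) 0).
  by apply: eq_bigr => i _; rewrite /sright sgr_id.
rewrite sum_sg // card_ord (Nneg_mxE char_poly_pencil0) -natrD; congr (_ - 2 * _%:R).
rewrite /Zdown_pos !card_sum_mem -big_split /=; apply: eq_bigr => i _.
rewrite !inE in_mem_set_pred.
have ns := near_sright (Lmu.1 i) (@mu_zeros i) 0.
case: (ltrgt0P (mu i 0)) => m0.
- rewrite sright_sg ?gt_eqF // gtr0_sg // ltNge ler01 /=.
  by case: asboolP => // -[mE]; move: m0; rewrite mE ltxx.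
- rewrite sright_sg ?lt_eqF // ltr0_sg // ltrN10 /=.
  by case: asboolP => // -[mE]; move: m0; rewrite mE ltxx.
- case: asboolP => [[_ mn]|mn].
    suff -> : sright (mu i) 0 < 0 by [].
    have : \forall y \near (0 : R)^'+, sright (mu i) 0 < 0.
      near=> y; have <- : Num.sg (mu i y) = sright (mu i) 0 by near: y; exact: ns.
      by rewrite sgr_lt0; near: y; exact: mn.
    by case/filter_ex.
  suff -> : (sright (mu i) 0 < 0) = false by [].
  apply/negP => sn; apply: mn; split => //.
  near=> y; rewrite -sgr_lt0.
  by have -> : Num.sg (mu i y) = sright (mu i) 0 by near: y; exact: ns.
Unshelve. all: by end_near. Qed.

Lemma sum_sleft0 : \sum_i sleft (mu i) 0 =
  N%:R - 2 * ((Nneg_mx (L ord0))%:R + (Zdown_neg mu)%:R).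
Proof.
have sl0 i : sleft (mu i) 0 != 0 by rewrite /sleft mulf_neq0 ?signr_eq0.
have -> : \sum_i sleft (mu i) 0 = \sum_i Num.sg (sleft (mu i) 0).
  by apply: eq_bigr => i _; rewrite /sleft sgrM sgrX sgrN1 /sright sgr_id.
rewrite sum_sg // card_ord (Nneg_mxE char_poly_pencil0) -natrD; congr (_ - 2 * _%:R).
rewrite /Zdown_neg !card_sum_mem -big_split /=; apply: eq_bigr => i _.
rewrite !inE in_mem_set_pred.
have ns := near_sleft (Lmu.1 i) (@mu_zeros i) 0.
case: (ltrgt0P (mu i 0)) => m0.
- rewrite sleft_sg ?gt_eqF // gtr0_sg // ltNge ler01 /=.
  by case: asboolP => // -[mE]; move: m0; rewrite mE ltxx.
- rewrite sleft_sg ?lt_eqF // ltr0_sg // ltrN10 /=.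
  by case: asboolP => // -[mE]; move: m0; rewrite mE ltxx.
- case: asboolP => [[_ mn]|mn].
    suff -> : sleft (mu i) 0 < 0 by [].
    have : \forall y \near (0 : R)^'-, sleft (mu i) 0 < 0.
      near=> y; have <- : Num.sg (mu i y) = sleft (mu i) 0 by near: y; exact: ns.
      by rewrite sgr_lt0; near: y; exact: mn.
    by case/filter_ex.
  suff -> : (sleft (mu i) 0 < 0) = false by [].
  apply/negP => sn; apply: mn; split => //.
  near=> y; rewrite -sgr_lt0.
  by have -> : Num.sg (mu i y) = sleft (mu i) 0 by near: y; exact: ns.
Unshelve. all: by end_near. Qed.

Hypothesis (Lu : L ord_max \in unitmx).

(** The limits at infinity exhibit the eigenvalues of the leading coefficient as nonzero reals, so
    none escapes both counts. *)
Lemma Nneg_add_Npos_lead : (Nneg_mx (L ord_max) + Npos_mx (L ord_max))%N = N.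
Proof.
have [|r [rE r0 _]] := limit_roots Lmu Lu (F := 0^'+) _ _ (@nbhs_right_neq R 0).
  exact: cvg_within.
by rewrite (Nneg_mxE rE) (Npos_mxE rE) card_neg_pos // card_ord.
Qed.

(** This is an explicit radius beyond which no characteristic value lies; the added 1 makes it
    strict, and positive for an empty list. *)
Lemma norm_lt_bound z : z \in zs -> `|z| < 1 + \sum_(z <- zs) `|z|.
Proof.
by move=> zz; rewrite (big_rem z) //= addrCA ltrDl ltr_pwDl // sumr_ge0.
Qed.

Let bound_gt0 : 0 < 1 + \sum_(z <- zs) `|z|.
Proof. by rewrite ltr_pwDl // sumr_ge0. Qed.

(** For small [y > 0] the point [1 / y] lies beyond all characteristic values. For a suitable such
    [y] the branches there have the signs of the [r i], because [y ^+ p > 0], and the sum telescopes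
    between 0 and [1 / y]. *)
Lemma sum_kappa_gt0 : \sum_(x <- zs | 0 < x) kappa mu x =
  (Nneg_mx (L ord0))%:R + (Zdown_pos mu)%:R - (Nneg_mx (L ord_max))%:R.
Proof.
have [|r [rE r0 /(_ [set y | 0 < y < (1 + \sum_(z <- zs) `|z|)^-1])[]]] :=
    limit_roots Lmu Lu (F := 0^'+) _ _ (@nbhs_right_neq R 0).
- exact: cvg_within.
- near=> y; apply/andP; split => //; near: y; apply: nbhs_right_lt.
  by rewrite invr_gt0.
move=> y [/andP[y0 yM] sgy].
have By z : z \in zs -> z < y^-1.
  move=> /norm_lt_bound zM; apply: le_lt_trans (ler_norm _) (lt_trans zM _).
  by rewrite -[ltLHS]invrK ltf_pV2 ?posrE ?invr_gt0.
have muy i : Num.sg (mu i y^-1) = Num.sg (r i).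
  by rewrite -sgy sgrM sgrX (gtr0_sg y0) expr1n mul1r.
have -> : \sum_(x <- zs | 0 < x) kappa mu x = \sum_(x <- zs | 0 < x < y^-1) kappa mu x.
  rewrite big_seq_cond [RHS]big_seq_cond; apply: eq_bigl => x.
  by case: (boolP (x \in zs)) => //= /By ->; rewrite andbT.
rewrite sum_kappa ?invr_gt0 // sum_sright0.
have -> : \sum_i sleft (mu i) y^-1 = \sum_i Num.sg (r i).
  by apply: eq_bigr => i _; rewrite sleft_sg ?muy // -sgr_eq0 muy sgr_eq0.
rewrite sum_sg // card_ord -(Nneg_mxE rE).
by move: (Nneg_mx (L ord_max)) (Nneg_mx _) (Zdown_pos _) => a b c; field.
Unshelve. all: by end_near. Qed.

(** For [y < 0] and odd [p] the factor [y ^+ p] is negative, so at [1 / y] the branches have the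
    signs opposite to those of the [r i]. *)
Lemma sum_kappa_lt0 : odd p -> \sum_(x <- zs | x < 0) kappa mu x =
  (Npos_mx (L ord_max))%:R - (Nneg_mx (L ord0))%:R - (Zdown_neg mu)%:R.
Proof.
move=> oddp.
have [|r [rE r0 /(_ [set y | - (1 + \sum_(z <- zs) `|z|)^-1 < y < 0])[]]] :=
    limit_roots Lmu Lu (F := 0^'-) _ _ (@nbhs_left_neq R 0).
- exact: cvg_within.
- near=> y; apply/andP; split => //; near: y; apply: nbhs_left_gt.
  by rewrite oppr_lt0 invr_gt0.
move=> y [/andP[yM y0] sgy].
have By z : z \in zs -> y^-1 < z.
  move=> /norm_lt_bound zM; apply: (@lt_le_trans _ _ (- `|z|)).
    rewrite ltrNr; apply: lt_trans zM _.
    by rewrite -[ltLHS]invrK -invrN ltf_pV2 ?posrE ?invr_gt0 ?oppr_gt0 // ltrNl.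
  by rewrite lerNl -normrN ler_norm.
have muy i : Num.sg (mu i y^-1) = - Num.sg (r i).
  by rewrite -sgy sgrM sgrX (ltr0_sg y0) -signr_odd oddp mulN1r opprK.
have -> : \sum_(x <- zs | x < 0) kappa mu x = \sum_(x <- zs | y^-1 < x < 0) kappa mu x.
  rewrite big_seq_cond [RHS]big_seq_cond; apply: eq_bigl => x.
  by case: (boolP (x \in zs)) => //= /By ->.
rewrite sum_kappa ?invr_lt0 // sum_sleft0.
have -> : \sum_i sright (mu i) y^-1 = - \sum_i Num.sg (r i).
  rewrite -sumrN; apply: eq_bigr => i _.
  by rewrite sright_sg ?muy // -sgr_eq0 muy oppr_eq0 sgr_eq0.
rewrite sum_sg // card_ord -(Nneg_mxE rE).
(* Splitting [N] into the two counts of the leading coefficient leaves only [Npos_mx]. *)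
have := congr1 (fun n => n%:R : R) Nneg_add_Npos_lead; rewrite natrD => <-.
move: (Nneg_mx (L ord_max)) (Npos_mx _) (Nneg_mx _) (Zdown_neg _) => a b c d.
by field.
Unshelve. all: by end_near. Qed.

End Zeros.
End Pencil.

Unset Implicit Arguments.

Theorem theorem6 (R : realType) (N l : nat)
  (L : 'I_(2 * l + 1).+1 -> 'M[R[i]]_N) :
  (forall j, hermitian_mx (L j)) ->
  L ord_max \in unitmx ->
  forall mu : 'I_N -> R -> R, eigen_branches L mu ->
  (N%:R - 2 * (Nneg_mx (L ord0))%:R - (Zdown_pos mu)%:R - (Zdown_neg mu)%:R
     + \sum_(x \in [set x : R | 0 < x /\ charval L (rC x)]) kappa mu x
     - \sum_(x \in [set x : R | x < 0 /\ charval L (rC x)]) kappa mu x = 0 :> R)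
  /\ ((Npos_pencil L)%:R >=
        `|(Nneg_mx (L ord0))%:R + (Zdown_pos mu)%:R - (Nneg_mx (L ord_max))%:R| :> R)
  /\ ((Nneg_pencil L)%:R >=
        `|(Nneg_mx (L ord0))%:R + (Zdown_neg mu)%:R - (Npos_mx (L ord_max))%:R| :> R).
Proof.
move=> hL Lu mu Lmu; have [zs uzs zsP] := charval_roots Lu.
have oddp : odd (2 * l + 1) by rewrite addn1 /= mul2n odd_double.
have Sp := sum_kappa_gt0 Lmu uzs zsP Lu.
have Sn := sum_kappa_lt0 Lmu uzs zsP Lu oddp.
rewrite /Npos_pencil /Nneg_pencil !(fsum_charval uzs zsP (fun x => 0 < x)).
rewrite !(fsum_charval uzs zsP (fun x => x < 0)) Sp Sn; split; last split.
(* After substitution of the two sums only [N] minus both counts of the leading coefficient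
   remains. *)
- have := congr1 (fun n => n%:R : R) (Nneg_add_Npos_lead Lmu Lu).
  rewrite natrD => <-.
  move: (Nneg_mx (L ord_max)) (Npos_mx _) (Nneg_mx _) (Zdown_pos _) (Zdown_neg _).
  by move=> a b c d e; ring.
- by rewrite -Sp; exact: norm_sum_kappa_le.
(* The sum over the negative characteristic values is the opposite of the quantity inside the
   norm. *)
- rewrite -normrN (_ : - _ = \sum_(x <- zs | x < 0) kappa mu x); last by rewrite Sn; ring.
  exact: norm_sum_kappa_le.
Qed.
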